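(* Let $U\subset P(m)$ be a shifted order ideal and let $t\ge 0$ be any integer. Then the squeezed complex $\Delta_t(U)$ is vertex decomposable with shedding vertex $1$. In particular, $\Delta_t(U)$ is shellable.
   Context: Notation. $\mathbb{K}$ is a field, $m\ge 1$, $P(m)=\mathbb{K}[x_1,\ldots,x_m]$; $[n]=\{1,\ldots,n\}$ and $[a,b]=\{c\in\mathbb{N} : a\le c\le b\}$ (empty if $a>b$). Order ideals. A monomial order ideal of $P(m)$ is a finite set $U$ of monomials of $P(m)$ closed under taking divisors; it is always assumed that $1,x_1,\ldots,x_m\in U$. $U$ is shifted if $x_iu\in U$ ($u$ a monomial) and $i<j\le m$ imply $x_ju\in U$. $d_{\max}(U)$ is the maximal degree of a monomial in $U$. Squeezed complexes. Put $d=d_{\max}(U)$ and let $t\ge 0$ be an integer. For $u=x_{i_1}\cdots x_{i_s}\in U$ with $i_1\le\cdots\le i_s$ set $$F_t(u)=\bigcup_{\ell=1}^s\{i_\ell+2(\ell-1),\,i_\ell+2\ell-1\}\cup[m+2s+1,\,m+t+d]\quad\text{if } s\le t,$$ $$F_t(u)=\bigcup_{\ell=1}^t\{i_\ell+2(\ell-1),\,i_\ell+2\ell-1\}\cup\bigcup_{\ell=t+1}^s\{i_\ell+\ell+t-1\}\cup[m+t+s+1,\,m+t+d]\quad\text{if } s\ge t.$$ Each $F_t(u)$ is a $(d+t)$-subset of $[m+t+d]$. $\Delta_t(U)$ is the pure $(d+t-1)$-dimensional simplicial complex on vertex set $[m+t+d]$ whose facets are the sets $F_t(u)$, $u\in U$.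 Combinatorial notions. For a simplicial complex $\Delta$ and a vertex $v$: the link is $\{G\in\Delta : v\notin G,\ G\cup\{v\}\in\Delta\}$ and the deletion is $\Delta\setminus v=\{G\in\Delta : v\notin G\}$. A pure simplicial complex $\Delta$ is vertex decomposable if either $\Delta=\{\emptyset\}$ or there is a vertex $v\in\Delta$, called a shedding vertex, such that the link of $v$ and the deletion $\Delta\setminus v$ are (pure and) vertex decomposable. A pure simplicial complex is shellable if its facets can be ordered $F_1,\ldots,F_n$ such that for each $1\le i\le n$ the set $\{G\subseteq F_i : G\not\subseteq F_j \text{ for } 1\le j\le i-1\}$ has a unique minimal element. *)

(* Defs.v *)
From mathcomp Require Import all_boot finmap.
From mathcomp Require Export mpoly.

Set Implicit Arguments.
Unset Strict Implicit.
Unset Printing Implicit Defensive.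

Local Open Scope fset_scope.
Local Open Scope nat_scope.

Section Complexes.
Variable V : choiceType.
Implicit Types (D : {fset {fset V}}) (F G H : {fset V}) (v : V).

(* A simplicial complex is given by the finite set of all its faces. *)
Definition simplicial_complex D : Prop :=
  fset0 \in D /\ forall F G, F \in D -> G `<=` F -> G \in D.

Definition facet D F : Prop :=
  F \in D /\ forall G, G \in D -> F `<=` G -> G = F.

Definition pure_complex D : Prop :=
  simplicial_complex D /\
  forall F G, facet D F -> facet D G -> #|` F| = #|` G|.

Definition link D v : {fset {fset V}} :=
  [fset G in D | (v \notin G) && (v |` G \in D)].

Definition deletion D v : {fset {fset V}} := [fset G in D | v \notin G].

Inductive vertex_decomposable : {fset {fset V}} -> Prop :=
| vd_empty_face : vertex_decomposable [fset fset0]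
| vd_shedding D v :
    pure_complex D -> [fset v] \in D ->
    vertex_decomposable (link D v) -> vertex_decomposable (deletion D v) ->
    vertex_decomposable D.

(* The conditions imposed on v in the constructor vd_shedding. *)
Definition shedding_vertex D v : Prop :=
  [/\ [fset v] \in D, vertex_decomposable (link D v)
    & vertex_decomposable (deletion D v)].

Definition minimal_in (P : {fset V} -> Prop) G : Prop :=
  P G /\ forall H, P H -> H `<=` G -> H = G.

(* The facets are listed as s = F_0, F_1, etc.: indices start at 0. *)
Definition shelling D (s : seq {fset V}) : Prop :=
  [/\ uniq s, forall F, F \in s <-> facet D F
    & forall i, i < size s ->
      exists! G, minimal_in (fun H => H `<=` nth fset0 s i /\
        forall j, j < i -> ~ H `<=` nth fset0 s j) G].

Definition shellable D : Prop := pure_complex D /\ exists s, shelling D s.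

End Complexes.

Section Squeezed.
Variable m : nat.
Implicit Types (U : {fset 'X_{1..m}}) (u v : 'X_{1..m}) (t d : nat).

(* Monomials are exponent vectors: 0 is the monomial 1, addition is the
   product, and the componentwise order (<=)%MM is divisibility. *)
Definition order_ideal U : Prop :=
  [/\ forall u v, u \in U -> (v <= u)%MM -> v \in U,
      0%MM \in U
    & forall i : 'I_m, U_(i)%MM \in U].

Definition shifted U : Prop :=
  forall u (i j : 'I_m), i < j ->
    (U_(i) + u)%MM \in U -> (U_(j) + u)%MM \in U.

Definition dmax U : nat := \max_(u <- U) mdeg u.

(* The sorted indices i_1 <= ... <= i_s of the variables of u, each repeated
   according to its exponent; the element i of 'I_m stands for x_(i+1). *)
Definition indices u : seq nat :=
  flatten [seq nseq (u i) i.+1 | i <- enum 'I_m].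

Definition idx u (l : nat) : nat := nth 0 (indices u) l.-1.

Definition interval (a b : nat) : {fset nat} := [fset c in index_iota a b.+1].

Definition squeezed_facet d t u : {fset nat} :=
  let s := mdeg u in
  if s <= t then
    (\bigcup_(l <- index_iota 1 s.+1)
        [fset (idx u l + 2 * (l - 1))%N; (idx u l + 2 * l - 1)%N])
    `|` interval (m + 2 * s + 1) (m + t + d)
  else
    (\bigcup_(l <- index_iota 1 t.+1)
        [fset (idx u l + 2 * (l - 1))%N; (idx u l + 2 * l - 1)%N])
    `|` (\bigcup_(l <- index_iota t.+1 s.+1) [fset (idx u l + l + t - 1)%N])
    `|` interval (m + t + s + 1) (m + t + d).

Definition squeezed_complex t U : {fset {fset nat}} :=
  \bigcup_(u <- U) fpowerset (squeezed_facet (dmax U) t u).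

End Squeezed.

(* Main.v *)
Require Import Defs.
From mathcomp Require Import all_boot finmap zify.

(** Homogenize the monomials of the order ideal: with [d] the maximal degree, a
monomial [u] of degree [s] becomes the weakly increasing word of length [d] that
lists the indices of its variables and ends with [d - s] letters [m + 1], so
that [m + 1] stands for the factor 1. Then the two cases in the definition of
[F_t(u)], and the interval at their end, merge into one recursive rule: reading
the word from the left, each of the first [t] letters [i] contributes two
consecutive vertices, each later letter contributes one, and the letter is
translated by the number of vertices used so far ([slots],
[squeezed_facet_slots]). Being a shifted order ideal becomes one condition: the
last occurrence of a letter below [m + 1] may be increased by one
([stable_words]): raising [m] to [m + 1] divides by a variable, and the other
raises are the shifts.

This class of words is closed under the two operations that are needed. If all
letters lie in [a, n] and [v] is the first possible vertex, a facet contains [v]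
exactly when its word starts with [a]. Hence the link of [v] comes from the words
[w] such that [a :: w] is a word of the family; when the letter [a] occupies two
vertices, the second is a cone point of this link. The deletion of [v] comes from
the words with all letters larger than [a]: if a word starts with [a], replacing
all its letters [a] by [a + 1] gives a word of the family whose facet covers the
old facet minus [v] ([slots_raise_min]), so the deletion is pure of the same
dimension. Induction on [n - a] plus the word length proves
[words_vertex_decomposable]; it ends at families of one word, that is, at
simplices.

Shellability holds for every vertex decomposable complex: list the facets of the
deletion of the shedding vertex [v], then [v] joined to the facets of the link.
If [v] is not a cone point, purity makes the facets of the deletion facets of the
complex; if it is, they are left out. *)

Set Implicit Arguments.
Unset Strict Implicit.
Unset Printing Implicit Defensive.

Local Open Scope fset_scope.
Local Open Scope nat_scope.

(** * Vertex decomposable complexes are shellable *)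

Section Shellability.
Variable V : choiceType.
Implicit Types (D : {fset {fset V}}) (F G H E : {fset V}) (v : V).

(** The faces of [F] that lie in no member of [old] form a Boolean interval
[[R, F]]. Unlike the uniqueness of a minimal new face, this form passes directly
from [F] to [v |` F]. *)
Definition new_faces_interval (old : seq {fset V}) F : Prop :=
  exists2 R, R `<=` F & forall H, H `<=` F ->
    ((forall E, E \in old -> ~ H `<=` E) <-> R `<=` H).

Definition interval_shelling D (s : seq {fset V}) : Prop :=
  [/\ uniq s, forall F, F \in s <-> facet D F
    & forall i, i < size s -> new_faces_interval (take i s) (nth fset0 s i)].

Lemma interval_shellingW D s : interval_shelling D s -> shelling D s.
Proof.
case=> us Ds sR; split=> // i lt_i_s; have [R sRi RP] := sR i lt_i_s.
have takeP H : (forall j, j < i -> ~ H `<=` nth fset0 s j) <->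
    (forall E, E \in take i s -> ~ H `<=` E).
  split=> [Hj E /(nthP fset0)[j]|Hs j lt_j_i].
    rewrite size_takel ?(ltnW lt_i_s) // => lt_j_i <-.
    by rewrite nth_take //; apply: Hj.
  by apply: Hs; rewrite -(nth_take _ lt_j_i) mem_nth // size_takel // ltnW.
have memP H : (H `<=` nth fset0 s i /\
    (forall j, j < i -> ~ H `<=` nth fset0 s j)) <->
    (H `<=` nth fset0 s i /\ R `<=` H).
  split=> -[sHi PH]; split=> //; first exact/(RP _ sHi)/takeP.
  exact/takeP/(RP _ sHi).
exists R; split.
  split; first exact/memP.
  by move=> H /memP[_ sRH] sHR; apply/eqP; rewrite eqEfsubset sHR.
move=> G [/memP[sGi sRG] minG].
by apply: minG => //; apply/memP.
Qed.

Lemma facet_above D G : G \in D -> exists2 F, facet D F & G `<=` F.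
Proof.
move=> DG; pose P (X : D) := G `<=` fsval X.
have P0 : P [` DG] by rewrite /P /= fsubset_refl.
case: (arg_maxnP (fun X : D => #|` fsval X|) P0) => X PX maxX.
exists (fsval X) => //; split=> [|H DH sXH]; first exact: fsvalP.
apply/esym/eqP; rewrite eqEfcard sXH /=.
exact: (maxX [` DH] (fsubset_trans PX sXH)).
Qed.

Lemma vertex_decomposable_pure D : vertex_decomposable D -> pure_complex D.
Proof.
case=> // {D}; have faceP F : F \in [fset fset0 : {fset V}] -> F = fset0.
  by rewrite inE => /eqP.
split=> [|F G [/faceP-> _] [/faceP-> _]] //.
by split=> [|F G /faceP-> ]; rewrite ?inE ?fsubset0.
Qed.

Lemma in_link D v G : simplicial_complex D ->
  (G \in link D v) = (v \notin G) && (v |` G \in D).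
Proof.
case=> _ Dsub; rewrite !inE /=; apply/andb_idl => /andP[_ DvG].
by apply: Dsub DvG _; rewrite fsubsetUr.
Qed.

Lemma in_deletion D v G : (G \in deletion D v) = (G \in D) && (v \notin G).
Proof. by rewrite !inE. Qed.

Lemma facet_link D v L : simplicial_complex D ->
  facet (link D v) L -> facet D (v |` L).
Proof.
move=> cD [/[!in_link]// /andP[vL DvL] maxL]; split=> // G DG svLG.
have vG : v \in G by move/fsubsetP: svLG; apply; rewrite fset1U1.
have <- // : G `\ v = L; last by rewrite fsetD1K.
apply: maxL; first by rewrite in_link // !inE eqxx fsetD1K.
by rewrite fsubsetD1 vL (fsubset_trans _ svLG) ?fsubsetUr.
Qed.

Lemma link_facet D v F : simplicial_complex D ->
  facet D F -> v \in F -> facet (link D v) (F `\ v).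
Proof.
move=> cD [DF maxF] vF; split; first by rewrite in_link // !inE eqxx fsetD1K.
move=> G /[!in_link]// /andP[vG DvG] sFG.
rewrite -(fsetU1K vG); congr (_ `\ _); apply: maxF => //.
by rewrite -(fsetD1K vF) fsetUS.
Qed.

Lemma deletion_facet D v F : facet D F -> v \notin F -> facet (deletion D v) F.
Proof.
case=> DF maxF vF; split=> [|G]; rewrite in_deletion ?DF //.
by case/andP=> DG _; apply: maxF.
Qed.

(** A face [G] whose join with [v] is missing lies in a facet of the complex that
avoids [v]; as that facet is also one of the deletion, both complexes have the
same dimension. *)
Lemma facet_deletion D v G : pure_complex D -> pure_complex (deletion D v) ->
  G \in D -> v |` G \notin D ->
  forall F, facet (deletion D v) F -> facet D F.
Proof.
move=> [[D0 Dsub] pD] [_ pdel] DG DvG F fF.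
have [G' fG' sGG'] := facet_above DG.
have vG' : v \notin G'.
  apply: contra DvG => vG'; apply: Dsub fG'.1 _.
  by rewrite fsubUset fsub1set vG'.
have /(facet_above) [F' fF' sFF'] : F \in D.
  by case: fF; rewrite in_deletion => /andP[].
have -> // : F = F'.
apply/eqP; rewrite eqEfcard sFF' /=.
by rewrite (pD _ _ fF' fG') (pdel _ _ fF (deletion_facet fG' vG')).
Qed.

Lemma fset1U_inj v (s : seq {fset V}) :
  (forall L, L \in s -> v \notin L) -> {in s &, injective (fun L => v |` L)}.
Proof.
by move=> vs L M /vs vL /vs vM eqLM; rewrite -(fsetU1K vL) eqLM fsetU1K.
Qed.

(** A new face of [v |` L] contains [v] as soon as [s1] covers the deletion, and
then its restriction is that of [L] joined with [v]. When [s1] is empty, [v]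
imposes nothing and the restriction of [L] is kept; this is the case of a cone
point [v]. *)
Lemma interval_shelling_cat D v s1 s2 : simplicial_complex D ->
  interval_shelling (link D v) s2 -> uniq s1 ->
  (forall F, F \in s1 <-> facet D F /\ v \notin F) ->
  (forall i, i < size s1 -> new_faces_interval (take i s1) (nth fset0 s1 i)) ->
  (s1 = [::] \/ forall H, H \in deletion D v -> exists2 E, E \in s1 & H `<=` E) ->
  interval_shelling D (s1 ++ [seq v |` L | L <- s2]).
Proof.
move=> cD [u2 f2 R2] u1 f1 R1 s1P.
have vs2 L : L \in s2 -> v \notin L.
  by move/f2=> [/[!in_link]// /andP[]].
split.
- rewrite cat_uniq u1 map_inj_in_uniq ?u2 ?andbT; last exact: fset1U_inj.
  apply/hasPn=> _ /mapP[L _ ->]; apply/negP=> /f1[_].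
  by rewrite fset1U1.
- move=> F; rewrite mem_cat; split=> [/orP[/f1[]//|/mapP[L /f2 fL ->]]|fF].
    exact: facet_link.
  have [vF|vF] := boolP (v \in F); last by apply/orP; left; apply/f1.
  apply/orP; right; apply/mapP; exists (F `\ v); last by rewrite fsetD1K.
  exact/f2/link_facet.
move=> i; rewrite size_cat size_map => lt_i.
rewrite nth_cat take_cat; case: ltnP => [/R1 //|le_i].
have : i - size s1 < size s2 by rewrite ltn_subLR.
move: (i - size s1) => j lt_j.
rewrite (nth_map fset0) //.
have [R sR RP] := R2 j lt_j; set L := nth fset0 s2 j in sR RP *.
have s2L : L \in s2 by apply: mem_nth.
have vL := vs2 _ s2L; have vR : v \notin R by apply: contra vL; apply/fsubsetP.
have eqD1 H : H `<=` v |` L -> H `\ v `<=` L by rewrite fsubDset.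
have takeP H : H `<=` v |` L ->
    (forall E, E \in [seq v |` L | L <- take j s2] -> ~ H `<=` E) <->
    R `<=` H `\ v.
  move=> sH; rewrite -RP ?eqD1 //; split=> sP E.
    move=> Ej sHE; apply: (sP (v |` E)); first exact: map_f.
    by rewrite -fsubDset.
  by case/mapP=> M Mj ->; rewrite -fsubDset; apply: sP.
rewrite -map_take; case: s1P => [->|s1P].
  exists R => [|H sH]; first by rewrite fsubsetU // sR orbT.
  by rewrite cat0s takeP // fsubsetD1 vR andbT.
exists (v |` R) => [|H sH]; first by rewrite fsetUS.
rewrite fsubUset fsub1set; split=> [sP|/andP[vH sRH] E].
  have vH : v \in H.
    apply: contraT => vH; have [|E s1E sHE] := s1P H; last first.
      by case: (sP E); rewrite ?mem_cat ?s1E.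
    have /f2[/[!in_link]// /andP[_ DvL] _] := s2L.
    by rewrite in_deletion vH (cD.2 _ _ DvL).
  rewrite vH /=; apply: (fsubset_trans (y := H `\ v)); last exact: fsubD1set.
  by apply/takeP=> // E Ej; apply: sP; rewrite mem_cat Ej orbT.
rewrite mem_cat => /orP[/f1[_ vE] sHE|]; last first.
  by move: E; apply/takeP; rewrite // fsubsetD1 sRH.
by case/negP: vE; move/fsubsetP: sHE; apply.
Qed.

Lemma vertex_decomposable_shelling D : vertex_decomposable D ->
  exists s, interval_shelling D s.
Proof.
elim=> {D} [|D v pD Dv vdl [s2 sh2] vdd [s1 sh1]].
  exists [:: fset0]; split=> // [F|[|//] _].
    rewrite !inE; split=> [/eqP->|[/[!inE]//]].
    by split=> [|G]; rewrite inE // => /eqP.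
  by exists fset0 => // H _; split=> //.
have cD := pD.1.
have [/hasP[G DG DvG]|/hasPn cone] :=
  boolP (has (fun G => v |` G \notin D) (enum_fset D)).
- exists (s1 ++ [seq v |` L | L <- s2]).
  have [u1 f1 R1] := sh1.
  apply: interval_shelling_cat => // [F|].
    split=> [/f1 fF|[fF vF]]; last exact/f1/deletion_facet.
    split; last by case: fF => /[!in_deletion]/andP[].
    exact: (facet_deletion pD (vertex_decomposable_pure vdd) DG DvG).
  by right=> H /facet_above[F /f1]; exists F.
exists ([::] ++ [seq v |` L | L <- s2]).
apply: interval_shelling_cat => // [F|]; last by left.
split=> // -[[DF maxF] vF]; have /cone/negPn DvF := DF.
by have /fsetP/(_ v) := maxF _ DvF (fsubsetUr _ _); rewrite fset1U1 (negPf vF).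
Qed.

Theorem vertex_decomposable_shellable D : vertex_decomposable D -> shellable D.
Proof.
move=> vdD; split; first exact: vertex_decomposable_pure.
have [s sh] := vertex_decomposable_shelling vdD.
by exists s; apply: interval_shellingW.
Qed.

End Shellability.

(** * Complexes given by lists of vertices *)

Section Generators.
Variable V : choiceType.
Implicit Types (D : {fset {fset V}}) (F G : {fset V}) (v : V) (s : seq V).

Definition generated D (I : Type) (W : I -> Prop) (f : I -> seq V) : Prop :=
  forall G, G \in D <-> exists2 w, W w & {subset G <= f w}.

Lemma generated_pure D I (W : I -> Prop) f k :
  generated D W f -> (exists w, W w) ->
  (forall w, W w -> uniq (f w) /\ size (f w) = k) -> pure_complex D.
Proof.
move=> genD [w0 Ww0] Wf.
have facet_card F : facet D F -> #|` F| = k.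
  case=> /genD[w Ww sFw] maxF; have [uw <-] := Wf w Ww.
  have -> : F = [fset x in f w].
    apply/esym/maxF; last by apply/fsubsetP=> x /sFw; rewrite inE.
    by apply/genD; exists w => // x; rewrite inE.
  by rewrite card_fseq undup_id.
split=> [|F G /facet_card-> /facet_card-> //].
split=> [|F G /genD[w Ww sFw] /fsubsetP sGF]; apply/genD.
  by exists w0 => // x; rewrite inE.
by exists w => // x /sGF/sFw.
Qed.

(** The link and the deletion of a cone point coincide. *)
Lemma cone_vertex_decomposable D v : pure_complex D ->
  (forall G, G \in D -> v |` G \in D) ->
  vertex_decomposable (deletion D v) -> vertex_decomposable D.
Proof.
move=> pD cone vdd; have [D0 _] := pD.1.
apply: (@vd_shedding _ D v) => //; first by rewrite -(fsetU0 [fset v]) cone.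
suff -> : link D v = deletion D v by [].
apply/fsetP=> G; rewrite (in_link _ _ pD.1) in_deletion andbC.
apply/andb_id2r => vG; apply/idP/idP => [DvG|/cone //].
by apply: pD.1.2 DvG _; rewrite fsubsetUr.
Qed.

(** A vertex put in front of every generator is a cone point, and its deletion is
generated by the remaining lists. *)
Lemma generated_cone D I (W : I -> Prop) f v k :
  generated D W (fun w => v :: f w) -> (exists w, W w) ->
  (forall w, W w -> uniq (v :: f w) /\ size (f w) = k) ->
  generated (deletion D v) W f /\
  (vertex_decomposable (deletion D v) -> vertex_decomposable D).
Proof.
move=> genD W0 Wf; split=> [G|].
  rewrite in_deletion; split=> [/andP[/genD[w Ww sGw] vG]|[w Ww sGw]].
    exists w => // x Gx; have := sGw x Gx; rewrite inE => /orP[/eqP xv|//].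
    by rewrite -xv Gx in vG.
  have [/= /andP[vfw _] _] := Wf w Ww; apply/andP; split.
    by apply/genD; exists w => // x /sGw; rewrite inE orbC => ->.
  by apply: contra vfw; apply: sGw.
apply: cone_vertex_decomposable.
  apply: (generated_pure (k := k.+1) genD) => // w /Wf[uw <-] //.
move=> G /genD[w Ww sGw]; apply/genD; exists w => // x.
by rewrite in_fset1U inE => /orP[-> //|/sGw]; rewrite inE.
Qed.

Lemma simplex_vertex_decomposable s D : uniq s ->
  (forall G, G \in D <-> {subset G <= s}) -> vertex_decomposable D.
Proof.
elim: s D => [|v s IHs] D us genD.
  suff -> : D = [fset fset0] by exact: vd_empty_face.
  apply/fsetP=> G; rewrite inE; apply/idP/eqP => [/genD sG|-> ].
    by apply/fsetP=> x; rewrite inE; apply/negbTE/negP => /sG.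
  exact/genD.
have gen1 : generated D (fun _ : unit => True) (fun _ => v :: s).
  by move=> G; split=> [/genD|[_ _ /genD]] //; exists tt.
have [||gen2 cone] // := generated_cone (k := size s) gen1.
apply/cone/IHs => [|G]; first by case/andP: us.
by split=> [/gen2[]|sG] //; apply/gen2; exists tt.
Qed.

End Generators.

(** * Complexes of stable families of words *)

Section Words.
Variable n : nat.
Implicit Types (w p q : seq nat) (W : seq nat -> Prop) (D : {fset {fset nat}}).

(** The vertices of the facet of a word: the first [t] letters take two vertices
each, the later ones one, and [o] counts the vertices used so far. If the word
has fewer than [t] letters, an interval completes it, so that the number of
vertices is the word length plus [t] in all cases; the interval starts where a
further letter [n] would. *)
Fixpoint slots t o w : seq nat :=
  match w, t with
  | [::], _ => iota (n + o) t
  | i :: w', 0 => i + o :: slots 0 o.+1 w'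
  | i :: w', t'.+1 => i + o :: (i + o).+1 :: slots t' o.+2 w'
  end.

Lemma size_slots t o w : size (slots t o w) = size w + t.
Proof.
elim: w t o => [|i w IHw] [|t] o //=; rewrite ?size_iota ?IHw //.
by rewrite addnS.
Qed.

Lemma slots_ge b t o w : b <= n -> all (leq b) w ->
  all (leq (b + o)) (slots t o w).
Proof.
move=> le_bn; elim: w t o => [|i w IHw] t o /=.
  by move=> _; apply/allP=> x; rewrite mem_iota; lia.
case/andP=> le_bi bw; case: t => [|t] /=.
  rewrite leq_add2r le_bi /=.
  by apply: sub_all (IHw _ _ bw) => x; rewrite addnS => /ltnW.
rewrite leq_add2r le_bi leqW ?leq_add2r //=.
by apply: sub_all (IHw _ _ bw) => x /=; lia.
Qed.

Lemma behead_slots_gt t o a w : a <= n -> all (leq a) w ->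
  all (leq (a + o).+1) (behead (slots t o (a :: w))).
Proof.
move=> le_an aw; case: t => [|t] /=; first by rewrite -addnS slots_ge.
by rewrite ltnSn; apply: sub_all (slots_ge t o.+2 le_an aw) => x /=; lia.
Qed.

Lemma slots_uniq t o w : sorted leq w -> all (leq^~ n) w ->
  uniq (slots t o w).
Proof.
elim: w t o => [|i w IHw] t o /=; first by rewrite iota_uniq.
move=> iw /andP[le_in wn].
have aw : all (leq i) w by apply: order_path_min iw => //; apply: leq_trans.
have sw := path_sorted iw.
have notin x o' t' : x < i + o' -> x \notin slots t' o' w.
  move=> lt_x; apply/negP => /(allP (slots_ge t' o' le_in aw)).
  by rewrite leqNgt lt_x.
case: t => [|t] /=; first by rewrite IHw // notin //; lia.
by rewrite inE !negb_or !notin ?IHw //; lia.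
Qed.

Lemma mem_first_slot a t o w : a < n -> a + o \in slots t o w ->
  ~~ all (leq a.+1) w.
Proof.
move=> lt_an wa; apply/negP=> aw.
by have /allP/(_ _ wa) := slots_ge t o lt_an aw; rewrite addSn ltnn.
Qed.

(** On words with all letters at least [a], only the letters [a] change. *)
Definition raise_min a w := map (maxn a.+1) w.

(** The vertices of an initial run of letters [a] fill an interval starting at
[a + o]; raising these letters moves the interval up by one, so that only its
first vertex is lost. *)
Lemma slots_raise_min a t o w : a < n -> sorted leq w -> all (leq a) w ->
  {subset [predD1 slots t o w & a + o] <= slots t o (raise_min a w)}.
Proof.
move=> lt_an; elim: w t o => [|i w IHw] t o; first by move=> _ _ x /andP[].
move=> iw /andP[le_ai aw].
have [lt_ai|le_ia] := ltnP a i.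
  suff -> : raise_min a (i :: w) = i :: w by move=> x /andP[].
  apply: map_id_in => j /[!inE]/orP[/eqP->|wj]; apply/maxn_idPr => //.
  by apply: leq_trans lt_ai _; apply: (allP (order_path_min leq_trans iw)).
have eq_ia : i = a by apply/eqP; rewrite eqn_leq le_ia.
subst i; have sw := path_sorted iw => x.
rewrite !inE /raise_min /= (maxn_idPl (leqnSn a)) -/(raise_min a w).
case: t => [|t] /=; rewrite !inE => /andP[/negPf xa]; rewrite xa /=.
  have [->|xa1] := eqVneq x (a + o.+1); first by rewrite addnS eqxx.
  by move=> wx; rewrite IHw ?orbT // !inE xa1.
have [->|xa1] := eqVneq x (a + o).+1; first by rewrite addSn ?eqxx.
have [->|xa2] := eqVneq x (a + o.+2); first by rewrite !addnS !addSn eqxx !orbT.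
by move=> /= wx; rewrite IHw ?orbT // !inE xa2.
Qed.

(** Families of weakly increasing words that are closed upwards for the
componentwise order; it is enough to raise the last of a run of equal letters,
which keeps the word sorted. The lower bound [a] is only a bound, so that both
the link and the deletion give families of the same kind. *)
Record stable_words a d W : Prop := StableWords {
  words_inhabited : exists w, W w;
  words_shape : forall w, W w ->
    [/\ size w = d, sorted leq w & all (fun i => a <= i <= n) w];
  words_raise : forall p b q, b < n -> all (leq b.+1) q ->
    W (p ++ b :: q) -> W (p ++ b.+1 :: q) }.

Section Decomposition.
Variables (a d t o : nat) (W : seq nat -> Prop) (D : {fset {fset nat}}).
Hypotheses (le_an : a <= n) (stW : stable_words a d W)
  (genD : generated D W (slots t o)).

Lemma word_ge w : W w -> all (leq a) w.
Proof. by case/(words_shape stW)=> _ _; apply: sub_all => i /andP[]. Qed.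

Lemma word_le w : W w -> all (leq^~ n) w.
Proof. by case/(words_shape stW)=> _ _; apply: sub_all => i /andP[]. Qed.

Lemma word_slots w : W w -> uniq (slots t o w) /\ size (slots t o w) = d + t.
Proof.
move=> Ww; have [sz sw _] := words_shape stW Ww.
by rewrite size_slots sz slots_uniq // word_le.
Qed.

Lemma words_pure : pure_complex D.
Proof. exact: generated_pure genD (words_inhabited stW) word_slots. Qed.

Lemma word_head w : W w -> ~~ all (leq a.+1) w -> exists w', w = a :: w'.
Proof.
move=> Ww; case: w Ww => [|i w] //= Ww; rewrite negb_and => aw; exists w.
congr (_ :: _); apply/eqP; rewrite eqn_leq; have /=/andP[-> _] := word_ge Ww.
rewrite andbT leqNgt; apply/negP => lt_ai; case/orP: aw; first by rewrite lt_ai.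
have [_ /(order_path_min leq_trans) iw _] := words_shape stW Ww.
by case/negP; apply: sub_all iw => j; apply: leq_trans.
Qed.

(** The letters [a] are raised one at a time, from the last one to the first. *)
Lemma words_raise_min w : a < n -> W w -> W (raise_min a w).
Proof.
move=> lt_an Ww; have := word_ge Ww.
rewrite -[raise_min a w]cat0s; move: Ww; rewrite -{1}[w]cat0s.
elim: w [::] => [|i w IHw] p //= Ww /andP[le_ai aw].
move: (IHw (rcons p i)); rewrite !cat_rcons => /(_ Ww aw) {}IHw.
have [lt_ai|le_ia] := ltnP a i; first by have /maxn_idPr-> := lt_ai.
have eq_ia : i = a by apply/eqP; rewrite eqn_leq le_ia.
rewrite eq_ia in IHw *; rewrite (maxn_idPl (leqnSn a)).
apply: (words_raise stW) => //; apply/allP=> _ /mapP[j _ ->].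
by rewrite leq_maxl.
Qed.

Lemma link_words : (exists w, W (a :: w)) ->
  stable_words a d.-1 (fun w => W (a :: w)).
Proof.
split=> // [w Ww|p b q lt_bn bq].
  have [sz /path_sorted ? /andP[_ ?]] := words_shape stW Ww.
  by rewrite -sz.
by rewrite -!cat_cons; apply: words_raise stW _ _ _ lt_bn bq.
Qed.

Lemma deletion_words : a < n ->
  stable_words a.+1 d (fun w => W w /\ all (leq a.+1) w).
Proof.
move=> lt_an; split.
- have [w Ww] := words_inhabited stW; exists (raise_min a w).
  split; first exact: words_raise_min.
  by apply/allP=> _ /mapP[j _ ->]; rewrite leq_maxl.
- move=> w [Ww aw]; have [-> -> _] := words_shape stW Ww; split=> //.
  by apply/allP=> i wi; rewrite (allP aw) // (allP (word_le Ww)).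
move=> p b q lt_bn bq [Ww]; rewrite all_cat /= => /and3P[ap ab aq].
split; first exact: words_raise stW _ _ _ lt_bn bq Ww.
by rewrite all_cat /= ap aq leqW.
Qed.

(** The first vertex [a + o] is left out of a facet that contains it by [behead];
for [t > 0] the list that remains starts with the second vertex of the letter
[a], which is common to all these facets. *)
Lemma link_generated : a < n ->
  generated (link D (a + o)) (fun w => W (a :: w))
    (fun w => behead (slots t o (a :: w))).
Proof.
move=> lt_an G; rewrite (in_link _ _ words_pure.1).
have slotsE w : slots t o (a :: w) = a + o :: behead (slots t o (a :: w)).
  by case: t.
split=> [/andP[vG /genD[w Ww sGw]]|[w Ww sGw]].
  have /sGw aw : a + o \in (a + o) |` G by rewrite fset1U1.
  have [w' eqw] := word_head Ww (mem_first_slot lt_an aw).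
  rewrite {}eqw in Ww sGw; exists w' => // x Gx.
  have := sGw x (fset1Ur _ Gx); rewrite slotsE inE => /orP[/eqP xa|//].
  by rewrite -xa Gx in vG.
apply/andP; split.
  apply/negP=> /sGw; have /andP[_ aw] := word_ge Ww.
  by move/(allP (behead_slots_gt t o le_an aw)); rewrite ltnn.
apply/genD; exists (a :: w) => // x; rewrite in_fset1U slotsE inE.
by case/orP=> [->//|/sGw->]; rewrite orbT.
Qed.

(** A face that avoids [a + o] but comes from a word with letters [a] is also a
face of the facet of the raised word. *)
Lemma deletion_generated : a < n ->
  generated (deletion D (a + o)) (fun w => W w /\ all (leq a.+1) w) (slots t o).
Proof.
move=> lt_an G; rewrite in_deletion; split.
  case/andP=> /genD[w Ww sGw] vG; exists (raise_min a w).
    split; first exact: words_raise_min.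
    by apply/allP=> _ /mapP[j _ ->]; rewrite leq_maxl.
  move=> x Gx; have [_ sw _] := words_shape stW Ww.
  apply: (slots_raise_min lt_an sw (word_ge Ww)).
  by rewrite !inE sGw // andbT; apply: contraNneq vG => <-.
case=> w [Ww aw] sGw; apply/andP; split; first by apply/genD; exists w.
by apply/negP=> /sGw wa; have := mem_first_slot lt_an wa; rewrite aw.
Qed.

End Decomposition.

(** The induction on [n - a + d] lowers [d] for the link of [a + o], and raises
[a] for its deletion, or for the whole complex when [a + o] is not a vertex. *)
Theorem words_vertex_decomposable a d t o W D : a <= n ->
  stable_words a d W -> generated D W (slots t o) ->
  vertex_decomposable D /\
  (a < n -> [fset a + o] \in D -> shedding_vertex D (a + o)).
Proof.
have [k] := ubnP (n - a + d); elim: k => // k IHk in a d t o W D *.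
move=> lt_k le_an stW genD; have [w0 Ww0] := words_inhabited stW.
have pD := words_pure stW genD.
have simplex : (forall w, W w -> w = w0) -> vertex_decomposable D.
  move=> W1; have [u0 _] := word_slots t o stW Ww0.
  apply: (simplex_vertex_decomposable u0) => G.
  split=> [/genD[w /W1->]|sG] //.
  by apply/genD; exists w0.
(* Only one word of length d has all its letters equal to n. *)
have [eq_an|ne_an] := eqVneq a n.
  split; last by rewrite eq_an ltnn.
  have Wn w : W w -> w = nseq d n.
    move=> Ww; have [sz _ /allP aw] := words_shape stW Ww.
    rewrite -sz; apply/all_pred1P/allP=> i /aw.
    by rewrite eq_an /= eqn_leq andbC.
  by apply: simplex => w /Wn->; rewrite (Wn w0).
have lt_an : a < n by rewrite ltn_neqAle ne_an.
have vd_deletion : vertex_decomposable (deletion D (a + o)).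
  have := IHk a.+1 d t o _ (deletion D (a + o)) _ lt_an (deletion_words stW lt_an)
          (deletion_generated stW genD lt_an).
  by case=> //; lia.
have [Da|Da] := boolP ([fset a + o] \in D); last first.
  (* No word contains the letter a, so a + 1 is also a lower bound. *)
  split=> //; apply: (IHk a.+1 d t o W D _ lt_an _ genD).1; first lia.
  split; [by exists w0 | move=> w Ww | exact: words_raise stW].
  have [-> -> wn] := words_shape stW Ww; split=> //; apply/allP=> i wi.
  have /andP[_ ->] := allP wn _ wi; rewrite andbT; move: i wi; apply/allP.
  apply: contraNT Da => /(word_head stW Ww)[w' eqw].
  apply/genD; exists w => // x; rewrite inE eqw => /eqP->.
  by case: (t) => [|t'] /=; rewrite inE eqxx.
have [w aw] : exists w, W (a :: w).
  have /genD[w Ww sw] := Da; have /sw aw : a + o \in [fset a + o] by rewrite inE.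
  have [w' eqw] := word_head stW Ww (mem_first_slot lt_an aw).
  by exists w'; rewrite -eqw.
have d_gt0 : 0 < d by have [<-] := words_shape stW aw.
have stL := link_words stW (ex_intro _ w aw).
have vd_link : vertex_decomposable (link D (a + o)).
  have := link_generated le_an stW genD lt_an.
  case: (t) => [|t'] /= genL.
    by apply: (IHk _ _ _ _ _ _ _ le_an stL genL).1; lia.
  have [|w1 Ww1|genE cone] := generated_cone (k := d.-1 + t') genL.
  - by exists w.
  - have [u1 s1] := word_slots t' o.+2 stL Ww1; split=> //=.
    rewrite u1 andbT; apply/negP => /(allP (slots_ge _ _ le_an _)).
    have /andP[_ w1a] := word_ge stW Ww1.
    by move/(_ w1a); lia.
  by apply/cone/(IHk _ _ _ _ _ _ _ le_an stL genE).1; lia.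
by split=> //; apply: vd_shedding Da vd_link vd_deletion.
Qed.

End Words.

(** * Squeezed complexes as complexes of words *)

(** After the prefix [p], the number of vertices used is [size p] plus one more for
each letter that took two. *)
Lemma mem_slots_cat n t o p q x :
  reflect ((exists2 l, l < size p &
              if l < t then x = nth 0 p l + o + l.*2 \/
                            x = (nth 0 p l + o + l.*2).+1
              else x = nth 0 p l + o + t + l) \/
           x \in slots n (t - size p) (o + size p + minn t (size p)) q)
    (x \in slots n t o (p ++ q)).
Proof.
apply: (iffP idP).
  elim: p t o => [|i p IHp] t o /=.
    by rewrite subn0 minn0 !addn0; right.
  case: t => [|t] /=; rewrite !inE.
    case/orP=> [/eqP->|/IHp[[l lt_l ->]|]]; first by left; exists 0 => //=; lia.
      by left; exists l.+1 => //=; lia.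
    by rewrite !sub0n !min0n !addn0 addSnnS; right.
  case/or3P=> [/eqP->|/eqP->|/IHp[[l lt_l]|]].
  - by left; exists 0 => //=; lia.
  - by left; exists 0 => //=; lia.
  - move=> xl; left; exists l.+1 => //=; rewrite ltnS.
    by move: xl; case: ifP => _; lia.
  rewrite subSS minnSS !addnS !addSn; by right.
elim: p t o => [|i p IHp] t o /=.
  by rewrite subn0 minn0 !addn0 => -[[]|].
case: t => [|t] /=; rewrite !inE.
  case=> [[[|l] /= lt_l xl]|xq]; first by rewrite xl !addn0 eqxx.
    by rewrite IHp ?orbT //; left; exists l => //; rewrite xl /=; lia.
  rewrite IHp ?orbT //; right; move: xq.
  by rewrite !sub0n !min0n !addn0 addSnnS.
case=> [[[|l] /= lt_l]|xq].
- by rewrite !addn0 => -[]->; rewrite eqxx ?orbT.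
- rewrite ltnS => xl; rewrite IHp ?orbT //; left; exists l => //.
  by move: xl; case: ifP => _; lia.
rewrite IHp ?orbT //; right; move: xq.
by rewrite subSS minnSS !addnS.
Qed.

(** The padding letters produce the final interval of a squeezed facet. *)
Lemma slots_nseq n t o k : slots n t o (nseq k n) = iota (n + o) (t + k).
Proof.
elim: k t o => [|k IHk] t o; first by rewrite addn0; case: t.
case: t => [|t] /=; rewrite IHk; first by rewrite addnS.
by rewrite !addnS.
Qed.

Section Homogenization.
Variable m : nat.
Implicit Types (u : 'X_{1..m}) (w p q : seq nat).

(** The letter [m.+1] is not counted: it stands for the factor 1. *)
Definition monomial_of w : 'X_{1..m} := [multinom count_mem j.+1 w | j < m].

Definition homogenized d u : seq nat := indices u ++ nseq (d - mdeg u) m.+1.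

Lemma count_indices u (j : 'I_m) : count_mem j.+1 (indices u) = u j.
Proof.
rewrite /indices count_flatten sumnE big_map big_map big_enum /= (bigD1 j) //=.
rewrite count_nseq /= eqxx mul1n big1 ?addn0 // => i ne_ij.
by rewrite count_nseq /= eqSS (inj_eq val_inj) (negPf ne_ij).
Qed.

Lemma size_indices u : size (indices u) = mdeg u.
Proof.
rewrite /indices size_flatten /shape sumnE big_map big_map big_enum mdegE /=.
by apply: eq_bigr => i _; rewrite size_nseq.
Qed.

Lemma mem_indices u i : i \in indices u -> 0 < i <= m.
Proof. by case/flatten_mapP=> j _ /nseqP[-> _]; rewrite /= ltn_ord. Qed.

Lemma indices_sorted u : sorted leq (indices u).
Proof.
rewrite /indices; have : sorted ltn (map val (enum 'I_m)).
  by rewrite val_enum_ord iota_ltn_sorted.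
rewrite !(sorted_pairwise leq_trans) (sorted_pairwise ltn_trans).
elim: (enum _) => //= i s IHs /andP[fi /IHs sfs].
rewrite pairwise_cat sfs andbT; apply/andP; split.
  apply/allrelP=> _ _ /nseqP[-> _] /flatten_mapP[j sj /nseqP[-> _]].
  by have /ltnW := allP fi _ (map_f val sj).
rewrite -(sorted_pairwise leq_trans).
by elim: (u i) => // -[|c] //= ->; rewrite leqnn.
Qed.

Lemma homogenized_sorted d u : sorted leq (homogenized d u).
Proof.
rewrite (sorted_pairwise leq_trans) pairwise_cat.
rewrite -!(sorted_pairwise leq_trans) indices_sorted /=; apply/andP; split.
  apply/allrelP=> i j /mem_indices/andP[_ le_im] /nseqP[-> _].
  exact: leq_trans le_im _.
by elim: (d - _) => // -[|k] //= ->; rewrite leqnn.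
Qed.

Lemma homogenized_letters d u :
  all (fun i => 0 < i <= m.+1) (homogenized d u).
Proof.
apply/allP=> i; rewrite mem_cat => /orP[/mem_indices/andP[-> ?]|/nseqP[-> _]].
  exact: leqW.
by rewrite /= ltnSn.
Qed.

Lemma size_homogenized d u : mdeg u <= d -> size (homogenized d u) = d.
Proof. by move=> le_d; rewrite size_cat size_indices size_nseq subnKC. Qed.

Lemma monomial_of_homogenized d u : monomial_of (homogenized d u) = u.
Proof.
apply/mnmP=> j; rewrite mnmE count_cat count_indices count_nseq /= eqSS.
by rewrite gtn_eqF ?addn0.
Qed.

(** A sorted word is determined by its letter counts; those of the letters up to
[m] are the exponents of its monomial, and the length gives that of [m.+1]. *)
Lemma homogenizedP d w : size w = d -> sorted leq w ->
  all (fun i => 0 < i <= m.+1) w ->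
  mdeg (monomial_of w) <= d /\ w = homogenized d (monomial_of w).
Proof.
move=> sz sw wm; set u := monomial_of w.
have perm_small : perm_eq (filter (leq^~ m) w) (indices u).
  apply/allP=> i _ /=; rewrite count_filter.
  have [/andP[i_gt0 le_im]|im] := boolP (0 < i <= m).
    have lt_im : i.-1 < m by lia.
    have := count_indices u (Ordinal lt_im); rewrite /= mnmE /= prednK // => ->.
    by apply/eqP/eq_count => j /=; case: eqP => // ->.
  rewrite (count_memPn (contra (@mem_indices u i) im)) -count_filter.
  apply/eqP/count_memPn; rewrite mem_filter; apply: contra im => /andP[-> wi].
  by have /andP[->] := allP wm i wi.
have size_small : size (filter (leq^~ m) w) = mdeg u.
  by rewrite (perm_size perm_small) size_indices.
have split_w := count_predC (leq^~ m) w; rewrite -!size_filter in split_w.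
have size_big : size (filter (predC (leq^~ m)) w) = d - mdeg u by lia.
split; first lia.
apply: (sorted_eq leq_trans anti_leq sw (homogenized_sorted d u)).
rewrite -(permPl (permEl (perm_filterC (leq^~ m) w))) perm_cat //.
rewrite -size_big; set big := filter _ w.
suff /all_pred1P<- : all (pred1 m.+1) big by [].
apply/allP=> i; rewrite mem_filter /= -ltnNge => /andP[lt_mi /(allP wm)].
by case/andP=> _ le_im; rewrite eqn_leq le_im.
Qed.

Lemma monomial_of_insert p q (j : 'I_m) :
  monomial_of (p ++ j.+1 :: q) = (U_(j) + monomial_of (p ++ q))%MM.
Proof.
apply/mnmP=> i; rewrite mnmDE mnm1E !mnmE !count_cat /= eqSS.
by rewrite (inj_eq val_inj) addnCA.
Qed.

Lemma monomial_of_insert_last p q :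
  monomial_of (p ++ m.+1 :: q) = monomial_of (p ++ q).
Proof.
apply/mnmP=> i; rewrite !mnmE !count_cat /= eqSS.
by rewrite gtn_eqF.
Qed.

Definition ideal_words (U : {fset 'X_{1..m}}) d w : Prop :=
  [/\ size w = d, sorted leq w, all (fun i => 0 < i <= m.+1) w
    & monomial_of w \in U].

Lemma sorted_raise p b q : sorted leq (p ++ b :: q) -> all (leq b.+1) q ->
  sorted leq (p ++ b.+1 :: q).
Proof.
rewrite !(sorted_pairwise leq_trans) !pairwise_cat /= !allrel_consr.
move=> /and3P[/andP[pb ->] -> /andP[_ ->]] ->; rewrite !andbT.
by apply: sub_all pb => i; apply: leqW.
Qed.

(** Raising a letter [b < m] exchanges a variable for the next one, which is a
shift; raising [m] drops a factor, which is a passage to a divisor. *)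
Lemma ideal_words_stable U d : order_ideal U -> shifted U ->
  stable_words m.+1 1 d (ideal_words U d).
Proof.
move=> [downU U0 _] shU; split.
- exists (homogenized d 0%MM); split.
  + by rewrite size_homogenized // mdeg0.
  + exact: homogenized_sorted.
  + exact: homogenized_letters.
  + by rewrite monomial_of_homogenized.
- by move=> w [].
move=> p b q lt_bm bq [sz sw wm Uw].
have b_gt0 : 0 < b by move: wm; rewrite all_cat /= => /and3P[_ /andP[]].
split.
- by rewrite -sz !size_cat.
- exact: sorted_raise.
- by move: wm; rewrite !all_cat /= => /and3P[-> _ ->]; rewrite lt_bm.
have lt_b1 : b.-1 < m by lia.
have := monomial_of_insert p q (Ordinal lt_b1); rewrite /= prednK // => eq_b.
have [eq_bm|ne_bm] := eqVneq b m.
  by rewrite eq_bm monomial_of_insert_last; apply: downU Uw _; rewrite eq_b lem_addl.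
have lt_b : b < m by lia.
rewrite (monomial_of_insert p q (Ordinal lt_b)).
by apply: (shU _ (Ordinal lt_b1)); rewrite -?eq_b //=; lia.
Qed.

Lemma mem_interval a b x : (x \in interval a b) = (a <= x <= b).
Proof. by rewrite !inE mem_index_iota. Qed.

(** For degree [s] the padding starts after [s + minn t s] vertices, hence at
[m + 2 * s + 1] or [m + t + s + 1]: these are the two cases of the definition. *)
Lemma squeezed_facet_slots d t u : mdeg u <= d ->
  squeezed_facet d t u =i slots m.+1 t 0 (homogenized d u).
Proof.
move=> le_ud x; rewrite /squeezed_facet /idx.
apply/idP/mem_slots_cat; rewrite size_indices slots_nseq mem_iota.
  case: (leqP (mdeg u) t) => [le_ut|lt_tu].
    rewrite in_fsetU mem_interval => /orP[/bigfcupP[l]|]; last by right; lia.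
    rewrite andbT mem_index_iota => /andP[l_gt0 le_l] xl; left.
    exists l.-1; first lia.
    have -> : l.-1 < t by lia.
    by move: xl; rewrite !inE => /orP[]/eqP; lia.
  rewrite !in_fsetU mem_interval => /orP[/orP[]/bigfcupP[l]|]; last by right; lia.
    rewrite andbT mem_index_iota => /andP[l_gt0 le_l] xl; left.
    exists l.-1; first lia.
    have -> : l.-1 < t by lia.
    by move: xl; rewrite !inE => /orP[]/eqP; lia.
  rewrite andbT mem_index_iota => /andP[l_gt0 le_l] xl; left.
  exists l.-1; first lia.
  have -> : (l.-1 < t) = false by lia.
  by move: xl; rewrite !inE => /eqP; lia.
case: (leqP (mdeg u) t) => [le_ut|lt_tu] [[l lt_l]|xl].
- rewrite (leq_trans lt_l le_ut) => xl; rewrite in_fsetU.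
  apply/orP; left; apply/bigfcupP; exists l.+1.
    by rewrite andbT mem_index_iota.
  by rewrite !inE /=; lia.
- by rewrite in_fsetU mem_interval; apply/orP; right; lia.
- rewrite !in_fsetU; case: ltnP => lt_lt xl; apply/orP; left; apply/orP.
    left; apply/bigfcupP; exists l.+1; first by rewrite andbT mem_index_iota.
    by rewrite !inE /=; lia.
  right; apply/bigfcupP; exists l.+1.
    by rewrite andbT mem_index_iota; lia.
  by rewrite !inE /=; lia.
by rewrite !in_fsetU mem_interval; apply/orP; right; lia.
Qed.

Lemma squeezed_complex_generated t U :
  generated (squeezed_complex t U) (ideal_words U (dmax U))
    (slots m.+1 t 0).
Proof.
have le_dmax u : u \in U -> mdeg u <= dmax U.
  by move=> Uu; rewrite /dmax; apply: (leq_bigmax_seq (F := fun v => mdeg v)).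
move=> G; split.
  case/bigfcupP=> u; rewrite andbT => Uu /[!fpowersetE]/fsubsetP sGu.
  exists (homogenized (dmax U) u); last first.
    by move=> x /sGu; rewrite squeezed_facet_slots ?le_dmax.
  split; rewrite ?size_homogenized ?monomial_of_homogenized ?le_dmax //.
    exact: homogenized_sorted.
  exact: homogenized_letters.
case=> w [sz sw wm Uw] sGw; have [le_w eqw] := homogenizedP sz sw wm.
apply/bigfcupP; exists (monomial_of w); rewrite ?andbT //.
rewrite fpowersetE; apply/fsubsetP=> x /sGw.
by rewrite squeezed_facet_slots // -eqw.
Qed.

End Homogenization.

Theorem theorem3p8 (m t : nat) (U : {fset 'X_{1..m}}) (hm : 1 <= m)
    (hU : order_ideal U) (hS : shifted U) :
  (vertex_decomposable (squeezed_complex t U) /\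
   shedding_vertex (squeezed_complex t U) 1) /\
  shellable (squeezed_complex t U).
Proof.
have genU := squeezed_complex_generated t U.
have stU := ideal_words_stable (dmax U) hU hS.
have [|vdU shedU] := words_vertex_decomposable _ stU genU; first by [].
split; last exact: vertex_decomposable_shellable.
split=> //; rewrite -[1]addn0; apply: shedU => //.
have [_ _ /(_ (Ordinal hm)) U1] := hU.
have le_1d : 1 <= dmax U.
  by rewrite -(mdeg1 (Ordinal hm)); apply: (leq_bigmax_seq (F := fun v => mdeg v)).
(* The vertex 1 lies in the facet of the monomial x_1. *)
apply/genU; exists (1 :: nseq (dmax U).-1 m.+1); last first.
  by move=> x; rewrite inE => /eqP->; case: (t) => [|t'] /=; rewrite inE.
split.
- by rewrite /= size_nseq prednK.
- by elim: (_.-1) => // -[|k] //= ->; rewrite leqnn.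
- by rewrite /= all_nseq leqnn orbT.
rewrite (monomial_of_insert [::] _ (Ordinal hm)).
suff -> : monomial_of m (nseq (dmax U).-1 m.+1) = 0%MM by rewrite addm0.
by apply/mnmP=> j; rewrite mnmE mnm0E count_nseq /= eqSS gtn_eqF.
Qed.
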